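(* Let $Q^{(1/2)}=\bigoplus_{k\ge0}Q^{(1/2)}_k$ with $Q^{(1/2)}_k=Q_{2k}$, the algebra $Q=\mathbf{C}[E_2,E_4,E_6]$ of quasi-modular forms with halved grading. Then $Q^{(1/2)}$ is the underlying Fock space for a quasi-vertex operator algebra $(Q^{(1/2)},Y,1,\rho)$. Here the vertex operators are $$Y(f,z)=e^{z\theta}f=\sum_{n\ge0}\frac{z^n}{n!}\theta^nf\qquad(\text{acting by multiplication}),\qquad \theta=q\frac{d}{dq},$$ i.e. $f(n)g=0$ for $n\ge0$ and $f(-n-1)g=\frac1{n!}(\theta^nf)g$ for $n\ge0$, and $\rho$ is given by $$L(1)\mapsto-\delta,\qquad L(0)\mapsto E,\qquad L(-1)\mapsto\theta,$$ where $\delta=\partial/\partial E_2$ is the lowering operator and $E$ is the Euler operator of $Q^{(1/2)}$ ($Ef=kf$ for $f\in Q^{(1/2)}_k$).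
   Context: Vertex algebra over $\mathbf{C}$: a vector space $V$ (the Fock space) with a nonzero vector $\mathbf 1$ (vacuum) and bilinear products $(a,b)\mapsto a(n)b$, $n\in\mathbf{Z}$ (encoded by $Y(a,z)=\sum_n a(n)z^{-n-1}$), such that $a(n)b=0$ for $n\gg0$ (depending on $a,b$), $a(n)\mathbf 1=0$ for $n\ge0$, $a(-1)\mathbf 1=a$, and for all $a,b,c\in V$, $r,s,t\in\mathbf{Z}$: $\sum_{i\ge0}\binom ri (a(t+i)b)(r+s-i)c=\sum_{i\ge0}(-1)^i\binom ti\{a(r+t-i)b(s+i)c-(-1)^t b(s+t-i)a(r+i)c\}$. A quasi-vertex operator algebra (QVOA) $(V,Y,\mathbf 1,\rho)$ is a vertex algebra with a grading $V=\bigoplus_{n\in\mathbf{Z}}V_n$ such that $\dim V_n<\infty$, $V_n=0$ for $n\ll0$, $a(n)b\in V_{k+\ell-n-1}$ for $a\in V_k,b\in V_\ell$, together with a representation $\rho$ of $\mathfrak{sl}_2$ on $V$ given by operators $L(-1),L(0),L(1)$ with $L(-1)a=a(-2)\mathbf 1$, $L(0)a=ka$ for $a\in V_k$, $L(1)V_k\subseteq V_{k-1}$, $[L(m),L(n)]=(m-n)L(m+n)$ for $m,n\in\{0,\pm1\}$, and for $a\in V_k$: $[L(-1),a(n)]=(L(-1)a)(n)=-n\,a(n-1)$ and $[L(1),a(n)]=(L(1)a)(n)+(2k-n-2)a(n+1)$. With $q=e^{2\pi i\tau}$: $E_2=1-24\sum_{n\ge1}\sigma_1(n)q^n$, $E_4=1+240\sum_{n\ge1}\sigma_3(n)q^n$,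 $E_6=1-504\sum_{n\ge1}\sigma_5(n)q^n$; $Q=\mathbf{C}[E_2,E_4,E_6]=\bigoplus_{k\ge0}Q_{2k}$ is the polynomial algebra of holomorphic quasi-modular forms for $\mathrm{SL}_2(\mathbf{Z})$, graded by weight ($E_{2i}$ has weight $2i$), and $\partial/\partial E_2$ is the partial derivative on it. The derivation $\theta$ preserves $Q$ and raises weights by $2$.
   Formalization: With E_2 = 1-24q-..., δ = ∂/∂E_2 gives [-δ,θ]E_2 = -E_2/6, not 2E_2, so the claim fails as written; the formal version takes δ = -12 ∂/∂E_2, i.e. ∂/∂E_2 for the normalization E_2 = -1/12 + 2Σσ_1(n)q^n. *)

(* Defs.v *)
From mathcomp Require Import all_boot all_order all_algebra.
From mathcomp Require Import reals complex.
From mathcomp Require Import mpoly.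

Set Implicit Arguments.
Unset Strict Implicit.
Unset Printing Implicit Defensive.

Import Order.TTheory GRing.Theory Num.Theory.
Local Open Scope ring_scope.

Section QuasiVertexOperatorAlgebra.
Variables (C : fieldType) (V : lmodType C).

(* The value x of a formally infinite sum of u i over i >= 0 with only finitely
   many nonzero terms: the partial sums are eventually constant if and only if
   the terms eventually vanish. *)
Definition finite_sum (u : nat -> V) (x : V) : Prop :=
  exists N : nat, forall M : nat, (N <= M)%N -> \sum_(i < M) u i = x.

Definition zbinom (r : int) (i : nat) : C :=
  (\prod_(j < i) (r - j%:Z)%:~R) / (i`!)%:R.

(* [prod a n b] is a(n)b. *)
Record is_vertex_algebra (prod : V -> int -> V -> V) (vac : V) : Prop := {
  va_linear_l : forall n b, linear (fun a => prod a n b);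
  va_linear_r : forall a n, linear (prod a n);
  va_vac_neq0 : vac != 0;
  va_truncation : forall a b, exists N : int, forall n : int, N <= n -> prod a n b = 0;
  va_vac_annihilation : forall a (n : int), 0 <= n -> prod a n vac = 0;
  va_creation : forall a, prod a (-1) vac = a;
  va_borcherds : forall (a b c : V) (r s t : int), exists x : V,
    finite_sum (fun i : nat =>
      zbinom r i *: prod (prod a (t + i%:Z) b) (r + s - i%:Z) c) x /\
    finite_sum (fun i : nat =>
      ((-1) ^+ i * zbinom t i) *:
        (prod a (r + t - i%:Z) (prod b (s + i%:Z) c)
         - (-1) ^ t *: prod b (s + t - i%:Z) (prod a (r + i%:Z) c))) x
}.

(* V is the internal direct sum of the subspaces [gr n], n in Z. *)
Record is_direct_grading (gr : int -> V -> Prop) : Prop := {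
  gr_zero : forall n, gr n 0;
  gr_linear : forall n (c : C) u v, gr n u -> gr n v -> gr n (c *: u + v);
  gr_generates : forall v, exists (s : seq int) (x : int -> V),
    (forall n, gr n (x n)) /\ v = \sum_(n <- s) x n;
  gr_independent : forall (s : seq int) (x : int -> V),
    uniq s -> (forall n, gr n (x n)) -> \sum_(n <- s) x n = 0 ->
    forall n, n \in s -> x n = 0
}.

Definition finite_dimensional (U : V -> Prop) : Prop :=
  exists2 b : seq V, (forall u, u \in b -> U u) &
    forall v, U v -> exists c : nat -> C, v = \sum_(i < size b) c i *: b`_i.

(* The representation rho of sl_2 is given by the operators [L m], of which only
   those with m = -1, 0, 1 are used. *)
Record is_qvoa (gr : int -> V -> Prop) (prod : V -> int -> V -> V) (vac : V)
    (L : int -> V -> V) : Prop := {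
  qvoa_va : is_vertex_algebra prod vac;
  qvoa_grading : is_direct_grading gr;
  qvoa_finite_dim : forall n, finite_dimensional (gr n);
  qvoa_bounded_below : exists N : int, forall (n : int) v, n < N -> gr n v -> v = 0;
  qvoa_prod_degree : forall (k l n : int) a b,
    gr k a -> gr l b -> gr (k + l - n - 1) (prod a n b);
  qvoa_L_linear : forall m : int, -1 <= m <= 1 -> linear (L m);
  qvoa_sl2 : forall (m n : int) v, -1 <= m <= 1 -> -1 <= n <= 1 ->
    L m (L n v) - L n (L m v) = (m - n)%:~R *: L (m + n) v;
  qvoa_Lm1 : forall a, L (-1) a = prod a (-2) vac;
  qvoa_L0 : forall (k : int) a, gr k a -> L 0 a = k%:~R *: a;
  qvoa_L1 : forall (k : int) a, gr k a -> gr (k - 1) (L 1 a);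
  qvoa_Lm1_comm : forall (k n : int) a b, gr k a ->
    L (-1) (prod a n b) - prod a n (L (-1) b) = prod (L (-1) a) n b /\
    prod (L (-1) a) n b = - (n%:~R *: prod a (n - 1) b);
  qvoa_L1_comm : forall (k n : int) a b, gr k a ->
    L 1 (prod a n b) - prod a n (L 1 b) =
      prod (L 1 a) n b + (2 * k - n - 2)%:~R *: prod a (n + 1) b
}.

End QuasiVertexOperatorAlgebra.

Section QuasiModularForms.
Variable R : realType.
Local Notation C := (R[i]).

(* The polynomial algebra C[E_2, E_4, E_6]; 'X_0, 'X_1, 'X_2 are E_2, E_4, E_6. *)
Local Notation Q := {mpoly C[3]}.

Definition sigma (k n : nat) : nat := \sum_(d <- divisors n) d ^ k.

(* n-th coefficient of the q-series E_2, E_4, E_6, for i = 0, 1, 2. *)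
Definition eisenstein_coef (i : 'I_3) (n : nat) : C :=
  if n == 0%N then 1 else
  match val i with
  | 0 => - 24 * (sigma 1 n)%:R
  | 1 => 240 * (sigma 3 n)%:R
  | _ => - 504 * (sigma 5 n)%:R
  end.

(* n-th coefficient of the q-series f(E_2, E_4, E_6). It only depends on the
   coefficients of E_2, E_4, E_6 of index at most n, so f can be evaluated at
   the truncated series, which are polynomials in q. *)
Definition qcoef (f : Q) (n : nat) : C :=
  (mmap (@polyC C) (fun i => \poly_(j < n.+1) eisenstein_coef i j) f)`_n.

(* theta acts as the operator q d/dq on q-series. *)
Definition is_q_derivative (theta : Q -> Q) : Prop :=
  forall (f : Q) (n : nat), qcoef (theta f) n = n%:R * qcoef f n.

(* Q^(1/2)_k = Q_{2k}: the measure [mnmwgt] gives E_2, E_4, E_6 the halved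
   weights 1, 2, 3. *)
Definition half_grading (k : int) (f : Q) : Prop :=
  match k with
  | Posz d => f \is d.-homog for @mnmwgt 3
  | Negz _ => f = 0
  end.

(* Negz n is the integer - n - 1. *)
Definition Yprod (theta : Q -> Q) (f : Q) (m : int) (g : Q) : Q :=
  match m with
  | Posz _ => 0
  | Negz n => ((n`!)%:R^-1 : C) *: iter n theta f * g
  end.

(* d/dE_2 for the generator normalised as E_2 = -1/12 + 2 sum_n sigma_1(n) q^n,
   which is -1/12 times 'X_0; hence the factor -12. It cannot be replaced by 1:
   12 theta('X_0) = 'X_0^2 - 'X_1 gives [d/d'X_0, theta] 'X_0 = (1/6) 'X_0,
   whereas [L(1), L(-1)] = 2 L(0) requires [- delta, theta] 'X_0 = 2 'X_0. *)
Definition delta (f : Q) : Q := (- 12 : C) *: mderiv ord0 f.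

Definition euler (f : Q) : Q :=
  \sum_(m <- msupp f) ((mnmwgt m)%:R * f@_m) *: 'X_[m].

Definition rho (theta : Q -> Q) (n : int) : Q -> Q :=
  if n == 1 then fun f => - delta f
  else if n == 0 then euler
  else theta.

End QuasiModularForms.

(* Main.v *)
Require Import Defs.
From HB Require Import structures.
From mathcomp Require Import all_boot all_order all_algebra.
From mathcomp Require Import reals complex.
From mathcomp Require Import mpoly.
From mathcomp Require Import ring zify.

(** Two independent facts make the theorem true.

    Analytic input: q d/dq preserves C[E_2, E_4, E_6].  This is Ramanujan's
    system of differential equations
      12 theta E_2 = E_2^2 - E_4,  3 theta E_4 = E_2 E_4 - E_6,
      2 theta E_6 = E_2 E_6 - E_4^2,
    which, coefficient by coefficient, evaluates the convolutions of the
    divisor sums sigma_1 * sigma_1, sigma_1 * sigma_3, sigma_1 * sigma_5 and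
    sigma_3 * sigma_3.  Such a convolution is a sum of a polynomial d(a, b) over
    the solutions of n = a x + b y in positive integers.  The substitution
    (a, x, b, y) |-> (a - b, x, b, x + y) maps the solutions with a > b
    onto those with x < y; so if r is symmetric and d(a, b) is the difference
    r(a, b) - r(a - b, b), also symmetric, then all contributions to the sum of
    d cancel except those of the diagonals a = b and x = y, which are divisor
    sums (rep_sum_shear_difference).  The powers of a^2 + ab + b^2 and the
    polynomial (ab(a + b))^2 are symmetric and turn under a |-> a - b into
    themselves with b |-> -b, so that d is twice the part of r that is
    odd in b; they give exactly the values needed (sigma_conv_1_1, sigma_conv_1_3,
    sigma_conv_3_3, sigma_conv_1_5_3_3).

    Algebraic input: any commutative algebra with a derivation D is a vertex
    algebra with Y(a, z) = e^(zD) a (holomorphic_vertex_algebra).  By Pascal's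
    rule the Borcherds identities satisfy the recursion
    B(r + 1, s, t) = B(r, s + 1, t) + B(r, s, t + 1), which reduces all of them
    to the case t >= 0, where both sides vanish, and the case r = 0, which is
    the Leibniz rule for the divided powers of D.

    The sl2-relations hold between the derivations theta, the Euler operator and
    -delta of the polynomial algebra, hence need only be checked on the three
    generators (vector_field_commutator), and the commutation rule of L(1) with
    modes follows from them by induction (lowering_mode). *)

Set Implicit Arguments.
Unset Strict Implicit.
Unset Printing Implicit Defensive.

Import Order.TTheory GRing.Theory Num.Theory.
Local Open Scope ring_scope.

(** * Divisor sums and representations n = a x + b y *)

Lemma big_seq_bij (V : nmodType) (I J : eqType) (s1 : seq I) (s2 : seq J)
    (h : I -> J) (h' : J -> I) (F : J -> V) :
  uniq s1 -> uniq s2 ->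
  (forall i, i \in s1 -> h i \in s2 /\ h' (h i) = i) ->
  (forall j, j \in s2 -> h' j \in s1 /\ h (h' j) = j) ->
  \sum_(j <- s2) F j = \sum_(i <- s1) F (h i).
Proof.
move=> u1 u2 H1 H2; rewrite -[RHS](big_map h xpredT F).
apply: perm_big; apply: uniq_perm => //.
  rewrite map_inj_in_uniq // => i j /H1[_ Ei] /H1[_ Ej] Eij.
  by rewrite -Ei Eij Ej.
move=> j; apply/idP/mapP => [/H2[? <-]|[i /H1[? _] ->]] //.
by exists (h' j).
Qed.

Lemma big_seq_bij_cond (V : nmodType) (I J : eqType) (s1 : seq I) (s2 : seq J)
    (P1 : pred I) (P2 : pred J) (h : I -> J) (h' : J -> I) (F : J -> V) :
  uniq s1 -> uniq s2 ->
  (forall i, i \in s1 -> P1 i -> [/\ h i \in s2, P2 (h i) & h' (h i) = i]) ->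
  (forall j, j \in s2 -> P2 j -> [/\ h' j \in s1, P1 (h' j) & h (h' j) = j]) ->
  \sum_(j <- s2 | P2 j) F j = \sum_(i <- s1 | P1 i) F (h i).
Proof.
move=> u1 u2 H1 H2; rewrite -big_filter -[RHS]big_filter.
apply: (big_seq_bij (h' := h')); rewrite ?filter_uniq // => i.
  by rewrite !mem_filter => /andP[Pi /H1] /(_ Pi) [-> -> ->].
by rewrite !mem_filter => /andP[Pi /H2] /(_ Pi) [-> -> ->].
Qed.

Lemma mem_pairs_dep (S T : eqType) (s : seq S) (t : S -> seq T) x y :
  ((x, y) \in [seq (i, j) | i <- s, j <- t i]) = (x \in s) && (y \in t x).
Proof.
apply/allpairsPdep/andP => [[i [j [si tj [-> ->]]]] //|[sx ty]].
by exists x, y.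
Qed.

Lemma uniq_pairs_dep (S T : eqType) (s : seq S) (t : S -> seq T) :
  uniq s -> (forall x, uniq (t x)) -> uniq [seq (i, j) | i <- s, j <- t i].
Proof.
move=> us ut; apply: allpairs_uniq_dep => //.
move=> [x1 y1] [x2 y2] _ _ /= E.
by have /= -> := congr1 fst E; have /= -> := congr1 snd E.
Qed.

Definition factor_pairs (n : nat) : seq (nat * nat) :=
  [seq (a, x) | a <- iota 1 n, x <- iota 1 n].

(** A quadruple ((a, x), (b, y)) stands for the representation n = a x + b y by
    positive integers. *)
Definition representations (n : nat) : seq ((nat * nat) * (nat * nat)) :=
  [seq t <- [seq (p, q) | p <- factor_pairs n, q <- factor_pairs n]
    | (t.1.1 * t.1.2 + t.2.1 * t.2.2 == n)%N].

Lemma mem_factor_pairs n a x :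
  ((a, x) \in factor_pairs n) = (0 < a <= n)%N && (0 < x <= n)%N.
Proof. by rewrite mem_pairs_dep !mem_iota !add1n !ltnS. Qed.

Lemma factor_pairs_uniq n : uniq (factor_pairs n).
Proof. by apply: uniq_pairs_dep => *; exact: iota_uniq. Qed.

Lemma representations_uniq n : uniq (representations n).
Proof.
by apply/filter_uniq/uniq_pairs_dep => *; exact: factor_pairs_uniq.
Qed.

Lemma mem_representations n a x b y :
  (((a, x), (b, y)) \in representations n) =
  [&& (0 < a)%N, (0 < x)%N, (0 < b)%N, (0 < y)%N & (a * x + b * y == n)%N].
Proof.
rewrite mem_filter mem_pairs_dep !mem_factor_pairs /=.
apply/idP/idP; first lia.
move=> /and5P[a0 x0 b0 y0 /eqP nE].
by apply/and3P; split; [exact/eqP|apply/and3P; split|apply/and3P; split]; nia.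
Qed.

Section ConvolutionSums.
Variable F : numFieldType.
Implicit Types (n : nat) (r d : nat -> nat -> F).

Lemma sum_factor_pairs n m (g : nat -> nat -> F) : (0 < m <= n)%N ->
  \sum_(p <- factor_pairs n | (p.1 * p.2 == m)%N) g p.1 p.2 =
  \sum_(e <- divisors m) g e (m %/ e)%N.
Proof.
move=> /andP[m0 mn]; rewrite -big_filter.
pose h e := (e, m %/ e)%N.
rewrite (@big_seq_bij F _ _ (divisors m) _ h fst) ?divisors_uniq //.
- by rewrite filter_uniq ?factor_pairs_uniq.
- move=> e; rewrite -dvdn_divisors // => em; split=> //.
  have e0 := dvdn_gt0 m0 em; have le_em := dvdn_leq m0 em.
  have em' := divnK em.
  rewrite mem_filter mem_factor_pairs /h /= mulnC em' eqxx.
  by rewrite divn_gt0 // (leq_trans le_em mn) e0 le_em (leq_trans (leq_div _ _) mn).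
- move=> [a x]; rewrite mem_filter mem_factor_pairs /h /=.
  move=> /and3P[/eqP E /andP[a0 _] _].
  by rewrite -dvdn_divisors // -E dvdn_mulr // mulKn.
Qed.

Lemma sum_sigma n m k : (0 < m <= n)%N ->
  (sigma k m)%:R = \sum_(p <- factor_pairs n | (p.1 * p.2 == m)%N) p.1%:R ^+ k :> F.
Proof.
move=> mn; rewrite (sum_factor_pairs (fun a _ => a%:R ^+ k)) //.
by rewrite /sigma natr_sum; apply: eq_bigr => i _; rewrite natrX.
Qed.

Definition rep_sum n d : F := \sum_(t <- representations n) d t.1.1 t.2.1.

(** Restricted to 0 < i < n because [sigma k 0] is 1, [divisors 0] being [:: 1]. *)
Definition sigma_conv n k l : F :=
  \sum_(i < n.+1 | (0 < i < n)%N) (sigma k i)%:R * (sigma l (n - i))%:R.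

(** A divisor pair of i and one of n - i together form a representation of n. *)
Lemma sigma_convE n k l :
  sigma_conv n k l = rep_sum n (fun a b => a%:R ^+ k * b%:R ^+ l).
Proof.
rewrite /sigma_conv; under eq_bigr => i /andP[i0 lt_in].
  rewrite (@sum_sigma n) ?i0 1?ltnW //.
  rewrite (@sum_sigma n (n - i)) ?subn_gt0 ?lt_in ?leq_subr //.
  rewrite big_mkcond [X in _ * X]big_mkcond big_distrlr /=.
  over.
rewrite exchange_big /rep_sum big_filter [RHS]big_mkcond big_allpairs /=.
rewrite big_seq [RHS]big_seq; apply: eq_bigr => -[a x].
rewrite mem_factor_pairs /= => /andP[/andP[a0 _] /andP[x0 _]].
rewrite exchange_big /= big_seq [RHS]big_seq; apply: eq_bigr => -[b y].
rewrite mem_factor_pairs /= => /andP[/andP[b0 _] /andP[y0 _]].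
have ax0 : (0 < a * x)%N by rewrite muln_gt0 a0.
have by0 : (0 < b * y)%N by rewrite muln_gt0 b0.
have [E|nE] := eqVneq.
  have lt : (a * x < n.+1)%N by lia.
  rewrite (bigD1 (Ordinal lt)) /=; last lia.
  rewrite eqxx ifT; last lia.
  rewrite big1 ?addr0 // => i /andP[_]; rewrite -val_eqE /= => ni.
  by rewrite ifN ?mul0r // eq_sym.
rewrite big1 // => i _; case: eqP => Ei; rewrite ?mul0r //.
by case: eqP => Ej; rewrite ?mulr0 //; have := ltn_ord i; lia.
Qed.

Definition divisor_splittings n : seq (nat * nat) :=
  [seq (e, i) | e <- divisors n, i <- index_iota 1 e].

Lemma divisor_splittings_uniq n : uniq (divisor_splittings n).
Proof. by apply: uniq_pairs_dep => [|e]; rewrite ?divisors_uniq ?iota_uniq. Qed.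

Lemma mem_divisor_splittings n e i : (0 < n)%N ->
  ((e, i) \in divisor_splittings n) = (e %| n)%N && (0 < i < e)%N.
Proof.
move=> n0; rewrite mem_pairs_dep mem_iota -dvdn_divisors //.
by case: (e %| n)%N => //=; lia.
Qed.

(** If x = y then (a + b) x = n, so the representation amounts to a divisor
    e = a + b of n with a splitting of e into two positive parts. *)
Lemma sum_diag_right n (G : (nat * nat) * (nat * nat) -> F) : (0 < n)%N ->
  \sum_(t <- representations n | t.1.2 == t.2.2) G t =
  \sum_(e <- divisors n) \sum_(1 <= i < e)
     G ((i, n %/ e), (e - i, n %/ e))%N.
Proof.
move=> n0; rewrite -big_filter.
rewrite -(big_allpairs_dep (I1 := nat) (I2 := fun=> nat) (h := fun e i => (e, i))
  (F := fun p => G ((p.2, n %/ p.1), (p.1 - p.2, n %/ p.1))%N)).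
pose h (p : nat * nat) := ((p.2, n %/ p.1), (p.1 - p.2, n %/ p.1))%N.
pose h' (t : (nat * nat) * (nat * nat)) := (t.1.1 + t.2.1, t.1.1)%N.
rewrite (@big_seq_bij F _ _ (divisor_splittings n) _ h h') //.
- exact: divisor_splittings_uniq.
- by rewrite filter_uniq ?representations_uniq.
- move=> [e i]; rewrite mem_divisor_splittings // => /andP[en /andP[i0 ie]].
  rewrite mem_filter mem_representations /h /h' /= eqxx -mulnDl.
  rewrite (subnKC (ltnW ie)) mulnC divnK // eqxx i0 subn_gt0 ie.
  by rewrite divn_gt0 ?(dvdn_leq n0 en) ?(dvdn_gt0 n0 en).
- move=> [[a x] [b y]]; rewrite mem_filter mem_representations /h /h' /=.
  move=> /andP[/eqP <- /and5P[a0 x0 b0 _ /eqP nE]].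
  rewrite mem_divisor_splittings // -nE -mulnDl dvdn_mulr // mulKn ?addn_gt0 ?a0 //.
  by rewrite addKn -{1}[a]addn0 ltn_add2l.
Qed.

Lemma sum_divisors_flip n (f : nat -> nat -> F) : (0 < n)%N ->
  \sum_(e <- divisors n) f e (n %/ e)%N = \sum_(e <- divisors n) f (n %/ e)%N e.
Proof.
move=> n0; pose h e := (n %/ e)%N.
have hP e : e \in divisors n -> h e \in divisors n /\ h (h e) = e.
  rewrite -!dvdn_divisors // /h => en; split; first exact: dvdn_div.
  by rewrite divnA // mulKn.
rewrite (@big_seq_bij F _ _ (divisors n) _ h h) ?divisors_uniq //.
by rewrite big_seq [RHS]big_seq; apply: eq_bigr => e /hP[_]; rewrite /h => ->.
Qed.

(** The case x = y with the roles of a, b and x, y exchanged: a = b = e leaves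
    n / e - 1 splittings of n / e as x + y. *)
Lemma sum_diag_left n (g : nat -> F) : (0 < n)%N ->
  \sum_(t <- representations n | t.1.1 == t.2.1) g t.1.1 =
  \sum_(e <- divisors n) ((n %/ e)%:R - 1) * g e.
Proof.
move=> n0; pose h (t : (nat * nat) * (nat * nat)) := ((t.1.2, t.1.1), (t.2.2, t.2.1)).
have hP t : t \in representations n -> h t \in representations n.
  case: t => [[a x] [b y]]; rewrite !mem_representations.
  by move=> /and5P[-> -> -> ->]; rewrite mulnC [(b * y)%N]mulnC => ->.
transitivity (\sum_(t <- representations n | t.1.2 == t.2.2) g t.1.2).
  apply: (big_seq_bij_cond (h := h) (h' := h) (fun t => g t.1.1));
    rewrite ?representations_uniq // => -[[a x] [b y]] /hP tn /= /eqP E; split=> //=;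
    exact/eqP.
rewrite (sum_diag_right (fun t => g t.1.2)) //.
rewrite -(sum_divisors_flip (fun e e' => (e%:R - 1) * g e')) //.
rewrite big_seq [RHS]big_seq; apply: eq_bigr => e; rewrite -dvdn_divisors // => en.
rewrite /= big_const_nat iter_addr addr0 -[LHS]mulr_natl.
by rewrite natrB // (dvdn_gt0 n0).
Qed.

Lemma rep_sum_swap n (P : nat -> nat -> nat -> nat -> bool) r :
  (forall a b, r a b = r b a) ->
  \sum_(t <- representations n | P t.2.1 t.2.2 t.1.1 t.1.2) r t.1.1 t.2.1 =
  \sum_(t <- representations n | P t.1.1 t.1.2 t.2.1 t.2.2) r t.1.1 t.2.1.
Proof.
move=> rC; pose h (t : (nat * nat) * (nat * nat)) := (t.2, t.1).
have hP t : t \in representations n -> h t \in representations n.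
  case: t => [[a x] [b y]]; rewrite !mem_representations.
  by move=> /and5P[-> -> -> ->]; rewrite addnC => ->.
rewrite (big_seq_bij_cond (s1 := representations n) (h := h) (h' := h)
   (P1 := fun t => P t.1.1 t.1.2 t.2.1 t.2.2) (fun t => r t.1.1 t.2.1)) ?representations_uniq //.
- by apply: eq_bigr => t _; rewrite rC.
- by move=> [p q] /hP.
- by move=> [p q] /hP.
Qed.

Lemma rep_sum_trichotomy n (u v : (nat * nat) * (nat * nat) -> nat) r :
  \sum_(t <- representations n | (u t < v t)%N) r t.1.1 t.2.1 =
  \sum_(t <- representations n | (v t < u t)%N) r t.1.1 t.2.1 ->
  rep_sum n r =
  \sum_(t <- representations n | u t == v t) r t.1.1 t.2.1
  + 2 * \sum_(t <- representations n | (v t < u t)%N) r t.1.1 t.2.1.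
Proof.
move=> E; rewrite /rep_sum (bigID (fun t => u t == v t)) /=; congr (_ + _).
rewrite (bigID (fun t => (u t < v t)%N)) /= mulr_natl mulr2n -{1}E.
congr (_ + _); apply: eq_bigl => t.
  by case: ltngtP.
by case: ltngtP.
Qed.

(** Since (a - b) x + b (x + y) = a x + b y, subtracting b from a and adding x to y
    preserves n; the inverse substitution is defined exactly when x < y. *)
Lemma rep_sum_shear n r :
  \sum_(t <- representations n | (t.1.2 < t.2.2)%N) r t.1.1 t.2.1 =
  \sum_(t <- representations n | (t.2.1 < t.1.1)%N) r (t.1.1 - t.2.1)%N t.2.1.
Proof.
pose h (t : (nat * nat) * (nat * nat)) :=
  ((t.1.1 - t.2.1, t.1.2), (t.2.1, t.1.2 + t.2.2))%N.
pose h' (t : (nat * nat) * (nat * nat)) :=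
  ((t.1.1 + t.2.1, t.1.2), (t.2.1, t.2.2 - t.1.2))%N.
apply: (big_seq_bij_cond (h := h) (h' := h') (fun t => r t.1.1 t.2.1));
  rewrite ?representations_uniq //.
- move=> [[a x] [b y]]; rewrite !mem_representations /h /h' /=.
  move=> /and5P[a0 -> -> y0 /eqP nE] ba.
  rewrite subn_gt0 ba addn_gt0 y0 orbT subnK ?(ltnW ba) // addKn.
  have -> : (x < x + y)%N by rewrite -{1}[x]addn0 ltn_add2l.
  split=> //=; apply/eqP; rewrite -nE.
  rewrite mulnDr addnA; congr (_ + _)%N.
  by rewrite mulnBl subnK // leq_mul2r (ltnW ba) orbT.
- move=> [[a x] [b y]]; rewrite !mem_representations /h /h' /=.
  move=> /and5P[a0 -> -> y0 /eqP nE] xy.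
  rewrite subn_gt0 xy addn_gt0 a0 subnKC ?(ltnW xy) // addnK.
  have -> : (b < a + b)%N by rewrite -{1}[b]add0n ltn_add2r.
  split=> //=; apply/eqP; rewrite -nE.
  rewrite mulnDl -addnA; congr (_ + _)%N.
  by rewrite -mulnDr subnKC // ltnW.
Qed.

(** By symmetry, the sum of r over a > b is half of its total up to the diagonal
    a = b, and the sum over x < y half of it up to the diagonal x = y.  The shear
    identifies the latter with the sum of r(a - b, b) over a > b, so that the
    difference, the sum of d over a > b, involves only diagonals. *)
Lemma rep_sum_shear_difference n r d : (0 < n)%N ->
  (forall a b, r a b = r b a) -> (forall a b, d a b = d b a) ->
  (forall a b, r (a + b)%N b = r a b + d (a + b)%N b) ->
  rep_sum n d =
  \sum_(e <- divisors n) \sum_(1 <= i < e) r i (e - i)%N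
  + \sum_(e <- divisors n) ((n %/ e)%:R - 1) * (d e e - r e e).
Proof.
move=> n0 rC dC rd.
pose Rx := \sum_(t <- representations n | t.1.2 == t.2.2) r t.1.1 t.2.1.
pose Ra := \sum_(t <- representations n | t.1.1 == t.2.1) r t.1.1 t.2.1.
pose Da := \sum_(t <- representations n | t.1.1 == t.2.1) d t.1.1 t.2.1.
pose Dlt := \sum_(t <- representations n | (t.2.1 < t.1.1)%N) d t.1.1 t.2.1.
pose Rlt := \sum_(t <- representations n | (t.2.1 < t.1.1)%N) r t.1.1 t.2.1.
pose Rsh := \sum_(t <- representations n | (t.1.2 < t.2.2)%N) r t.1.1 t.2.1.
have dE : rep_sum n d = Da + 2 * Dlt.
  apply: (@rep_sum_trichotomy _ (fun t => t.1.1) (fun t => t.2.1)).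
  exact: (@rep_sum_swap n (fun a _ b _ => b < a)%N).
have rEa : rep_sum n r = Ra + 2 * Rlt.
  apply: (@rep_sum_trichotomy _ (fun t => t.1.1) (fun t => t.2.1)).
  exact: (@rep_sum_swap n (fun a _ b _ => b < a)%N).
have rEx : rep_sum n r = Rx + 2 * Rsh.
  rewrite (@rep_sum_trichotomy _ (fun t => t.2.2) (fun t => t.1.2)).
    by congr (_ + _); apply: eq_bigl => t; rewrite eq_sym.
  exact: (@rep_sum_swap n (fun _ x _ y => x < y)%N).
have E : Rlt = Rsh + Dlt.
  rewrite /Rsh rep_sum_shear -big_split; apply: eq_bigr => t ltba /=.
  by rewrite -{1 3}(subnK (ltnW ltba)) rd.
have DaRa : Da - Ra = \sum_(e <- divisors n) ((n %/ e)%:R - 1) * (d e e - r e e).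
  rewrite -(sum_diag_left (fun e => d e e - r e e)) // -sumrB.
  by apply: eq_bigr => t /eqP <-.
rewrite -(sum_diag_right (fun t => r t.1.1 t.2.1)) // -/Rx -DaRa dE.
have -> : Rx = Ra + 2 * Rlt - 2 * Rsh by rewrite -rEa rEx addrK.
by rewrite E; ring.
Qed.

(** Faulhaber's formulas up to degree 6, the highest degree in which r occurs
    below. *)
Lemma sum_polynomial6 (c0 c1 c2 c3 c4 c5 c6 : F) m (z := m%:R : F) : (0 < m)%N ->
  \sum_(1 <= i < m) (c0 + c1 * i%:R + c2 * i%:R ^+ 2 + c3 * i%:R ^+ 3
     + c4 * i%:R ^+ 4 + c5 * i%:R ^+ 5 + c6 * i%:R ^+ 6) =
  c0 * (z - 1) + c1 * (z ^+ 2 / 2 - z / 2)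
  + c2 * (z ^+ 3 / 3 - z ^+ 2 / 2 + z / 6)
  + c3 * (z ^+ 4 / 4 - z ^+ 3 / 2 + z ^+ 2 / 4)
  + c4 * (z ^+ 5 / 5 - z ^+ 4 / 2 + z ^+ 3 / 3 - z / 30)
  + c5 * (z ^+ 6 / 6 - z ^+ 5 / 2 + 5 / 12 * z ^+ 4 - z ^+ 2 / 12)
  + c6 * (z ^+ 7 / 7 - z ^+ 6 / 2 + z ^+ 5 / 2 - z ^+ 3 / 6 + z / 42).
Proof.
rewrite {}/z; case: m => // m _; elim: m => [|m IH].
  by rewrite big_geq //; field.
by rewrite big_nat_recr //= IH -[m.+2%:R]natr1; field.
Qed.

Lemma sigma_convC n k l : sigma_conv n k l = sigma_conv n l k.
Proof.
rewrite !sigma_convE /rep_sum.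
pose h (t : (nat * nat) * (nat * nat)) := (t.2, t.1).
rewrite (@big_seq_bij F _ _ (representations n) _ h h) ?representations_uniq //.
- by apply: eq_bigr => t _; rewrite mulrC.
all: move=> [[a x] [b y]]; rewrite !mem_representations addnC.
all: by move=> /and5P[-> -> -> -> ->].
Qed.

Lemma natr_sigma n k : (sigma k n)%:R = \sum_(e <- divisors n) e%:R ^+ k :> F.
Proof. by rewrite natr_sum; apply: eq_bigr => e _; rewrite natrX. Qed.

Lemma sum_diag_monomial n k : (0 < n)%N ->
  \sum_(e <- divisors n) ((n %/ e)%:R - 1) * e%:R ^+ k.+1 =
  n%:R * (sigma k n)%:R - (sigma k.+1 n)%:R :> F.
Proof.
move=> n0; rewrite !natr_sigma mulr_sumr -sumrB big_seq [RHS]big_seq.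
apply: eq_bigr => e; rewrite -dvdn_divisors // => /divnK en.
by rewrite -[in RHS]en natrM exprS; ring.
Qed.

Lemma rep_sum_lin n (c1 c2 : F) (d1 d2 : nat -> nat -> F) :
  rep_sum n (fun a b => c1 * d1 a b + c2 * d2 a b) =
  c1 * rep_sum n d1 + c2 * rep_sum n d2.
Proof. by rewrite /rep_sum !mulr_sumr -big_split. Qed.

(** For a homogeneous polynomial r the value d(e, e) - r(e, e) = - r(0, e) is a
    monomial in e, and the sum of r over the splittings of e is a polynomial P in
    e; thus everything becomes a combination of divisor sums at n. *)
Lemma rep_sum_eval n r d (P : nat -> F) m k : (0 < n)%N ->
  (forall a b, r a b = r b a) -> (forall a b, d a b = d b a) ->
  (forall a b, r (a + b)%N b = r a b + d (a + b)%N b) ->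
  (forall e, d e e - r e e = m * e%:R ^+ k.+1) ->
  (forall e, (0 < e)%N -> \sum_(1 <= i < e) r i (e - i)%N = P e) ->
  rep_sum n d = \sum_(e <- divisors n) P e
    + m * (n%:R * (sigma k n)%:R - (sigma k.+1 n)%:R).
Proof.
move=> n0 rC dC rd dr rP; rewrite (rep_sum_shear_difference n0 rC dC rd).
congr (_ + _).
  rewrite big_seq [RHS]big_seq; apply: eq_bigr => e.
  by rewrite -dvdn_divisors // => /dvdn_gt0-/(_ n0)/rP.
rewrite -sum_diag_monomial // mulr_sumr; apply: eq_bigr => e _.
by rewrite dr mulrCA.
Qed.

Lemma sum_splittings (r : nat -> nat -> F) (c0 c1 c2 c3 c4 c5 c6 : F) e :
  (forall i j, (e = i + j)%N -> r i j = c0 + c1 * i%:R + c2 * i%:R ^+ 2 + c3 * i%:R ^+ 3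
     + c4 * i%:R ^+ 4 + c5 * i%:R ^+ 5 + c6 * i%:R ^+ 6) ->
  \sum_(1 <= i < e) r i (e - i)%N =
  \sum_(1 <= i < e) (c0 + c1 * i%:R + c2 * i%:R ^+ 2 + c3 * i%:R ^+ 3
     + c4 * i%:R ^+ 4 + c5 * i%:R ^+ 5 + c6 * i%:R ^+ 6).
Proof. by move=> rE; apply: eq_big_nat => i /andP[_ /ltnW ie]; apply: rE; rewrite subnKC. Qed.

(** The invariance behind the choice: quad (a - b) b = a^2 - ab + b^2 differs from
    quad a b only by the sign of b. *)
Let quad (a b : nat) : F := a%:R ^+ 2 + a%:R * b%:R + b%:R ^+ 2.

Lemma sigma_conv_1_1 n : (0 < n)%N ->
  2 * sigma_conv n 1 1 = 5 / 6 * (sigma 3 n)%:R + 1 / 6 * (sigma 1 n)%:R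
   - n%:R * (sigma 1 n)%:R.
Proof.
move=> n0; pose d (a b : nat) : F := 2 * (a%:R ^+ 1 * b%:R ^+ 1).
have -> : 2 * sigma_conv n 1 1 = rep_sum n d.
  by rewrite sigma_convE /rep_sum mulr_sumr.
rewrite (@rep_sum_eval n quad d (fun e => 5 / 6 * e%:R ^+ 3 - e%:R ^+ 2 + 1 / 6 * e%:R ^+ 1) (-1) 1) //.
- rewrite !big_split /= sumrN -!mulr_sumr -!natr_sigma; ring.
- by move=> a b; rewrite /quad; ring.
- by move=> a b; rewrite /d; ring.
- by move=> a b; rewrite /quad /d natrD; ring.
- by move=> e; rewrite /quad /d; ring.
- move=> e e0; rewrite (@sum_splittings _ (e%:R ^+ 2) (- e%:R) 1 0 0 0 0).
    by rewrite sum_polynomial6 //; field.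
  by move=> i j ->; rewrite natrD /quad; ring.
Qed.

Lemma sigma_conv_1_3 n : (0 < n)%N ->
  8 * sigma_conv n 1 3 = 7 / 10 * (sigma 5 n)%:R + 1 / 3 * (sigma 3 n)%:R
   - 1 / 30 * (sigma 1 n)%:R - n%:R * (sigma 3 n)%:R.
Proof.
move=> n0; pose d (a b : nat) : F :=
  4 * (a%:R ^+ 1 * b%:R ^+ 3) + 4 * (a%:R ^+ 3 * b%:R ^+ 1).
have -> : 8 * sigma_conv n 1 3 = rep_sum n d.
  by rewrite rep_sum_lin -!sigma_convE (sigma_convC n 3); ring.
pose r (a b : nat) : F := quad a b ^+ 2.
rewrite (@rep_sum_eval n r d (fun e => 7 / 10 * e%:R ^+ 5
   - e%:R ^+ 4 + 1 / 3 * e%:R ^+ 3 + (- (1 / 30)) * e%:R ^+ 1) (-1) 3) //.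
- rewrite !big_split /= sumrN -!mulr_sumr -!natr_sigma; ring.
- by move=> a b; rewrite /r /quad; ring.
- by move=> a b; rewrite /d; ring.
- by move=> a b; rewrite /r /quad /d natrD; ring.
- by move=> e; rewrite /r /quad /d; ring.
- move=> e e0; rewrite (@sum_splittings _ (e%:R ^+ 4) (- 2 * e%:R ^+ 3)
     (3 * e%:R ^+ 2) (- 2 * e%:R) 1 0 0).
    by rewrite sum_polynomial6 //; field.
  by move=> i j ->; rewrite natrD /r /quad; ring.
Qed.

(** This is the identity E_4^2 = E_8; here r vanishes for a = 0, which is why no
    term n * sigma occurs. *)
Lemma sigma_conv_3_3 n : (0 < n)%N ->
  4 * sigma_conv n 3 3 = 1 / 30 * (sigma 7 n)%:R - 1 / 30 * (sigma 3 n)%:R.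
Proof.
move=> n0; pose d (a b : nat) : F := 4 * (a%:R ^+ 3 * b%:R ^+ 3).
have -> : 4 * sigma_conv n 3 3 = rep_sum n d.
  by rewrite sigma_convE /rep_sum mulr_sumr.
pose r (a b : nat) : F := (a%:R * b%:R * (a + b)%:R) ^+ 2.
rewrite (@rep_sum_eval n r d
   (fun e => 1 / 30 * e%:R ^+ 7 + (- (1 / 30)) * e%:R ^+ 3) 0 0) //.
- rewrite !big_split /= -!mulr_sumr -!natr_sigma; ring.
- by move=> a b; rewrite /r natrD; ring.
- by move=> a b; rewrite /d; ring.
- by move=> a b; rewrite /d /r !natrD; ring.
- by move=> e; rewrite /d /r natrD; ring.
- move=> e e0; rewrite (@sum_splittings _ 0 0 (e%:R ^+ 4) (- 2 * e%:R ^+ 3)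
     (e%:R ^+ 2) 0 0).
    by rewrite sum_polynomial6 //; field.
  by move=> i j ->; rewrite /r natrD; ring.
Qed.

Lemma sigma_conv_1_5_3_3 n : (0 < n)%N ->
  12 * sigma_conv n 1 5 + 14 * sigma_conv n 3 3 =
   83 / 140 * (sigma 7 n)%:R + 1 / 2 * (sigma 5 n)%:R - 7 / 60 * (sigma 3 n)%:R
   + 1 / 42 * (sigma 1 n)%:R - n%:R * (sigma 5 n)%:R.
Proof.
move=> n0; pose d (a b : nat) : F :=
  6 * (a%:R ^+ 1 * b%:R ^+ 5 + a%:R ^+ 5 * b%:R ^+ 1) + 14 * (a%:R ^+ 3 * b%:R ^+ 3).
have -> : 12 * sigma_conv n 1 5 + 14 * sigma_conv n 3 3 = rep_sum n d.
  rewrite (rep_sum_lin n 6 14 (fun a b => a%:R ^+ 1 * b%:R ^+ 5 + a%:R ^+ 5 * b%:R ^+ 1)).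
  rewrite {1}/rep_sum big_split /= -/(rep_sum n (fun a b => a%:R ^+ 1 * b%:R ^+ 5)).
  by rewrite -/(rep_sum n (fun a b => a%:R ^+ 5 * b%:R ^+ 1)) -!sigma_convE (sigma_convC n 5); ring.
pose r (a b : nat) : F := quad a b ^+ 3.
rewrite (@rep_sum_eval n r d (fun e => 83 / 140 * e%:R ^+ 7
   - e%:R ^+ 6 + 1 / 2 * e%:R ^+ 5 + (- (7 / 60)) * e%:R ^+ 3 + 1 / 42 * e%:R ^+ 1) (-1) 5) //.
- rewrite !big_split /= sumrN -!mulr_sumr -!natr_sigma; ring.
- by move=> a b; rewrite /r /quad; ring.
- by move=> a b; rewrite /d; ring.
- by move=> a b; rewrite /r /quad /d natrD; ring.
- by move=> e; rewrite /r /quad /d; ring.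
- move=> e e0; rewrite (@sum_splittings _ (e%:R ^+ 6) (- 3 * e%:R ^+ 5)
     (6 * e%:R ^+ 4) (- 7 * e%:R ^+ 3) (6 * e%:R ^+ 2) (- 3 * e%:R) 1).
    by rewrite sum_polynomial6 //; field.
  by move=> i j ->; rewrite natrD /r /quad; ring.
Qed.

(** E_2, E_4, E_6 are the cases (c, k) = (-24, 1), (240, 3), (-504, 5). *)
Definition eisenstein (c : F) k n : F := if n == 0%N then 1 else c * (sigma k n)%:R.

Lemma eisenstein_cauchy c c' k l n : (0 < n)%N ->
  \sum_(i < n.+1) eisenstein c k i * eisenstein c' l (n - i) =
  eisenstein c k n + eisenstein c' l n + c * c' * sigma_conv n k l.
Proof.
move=> n0; rewrite (bigD1 ord0) //= (bigD1 ord_max) /=; last first.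
  by rewrite -val_eqE /= -lt0n.
rewrite subn0 subnn /eisenstein /= mul1r mulr1 addrCA addrA; congr (_ + _).
rewrite mulr_sumr; apply: eq_big => i; rewrite -!val_eqE /= -lt0n.
  by have := ltn_ord i; lia.
move=> /andP[i0 ni]; have lt_in : (i < n)%N by have := ltn_ord i; lia.
by rewrite eqn0Ngt i0 /= subn_eq0 leqNgt lt_in /=; ring.
Qed.

Lemma ramanujan_E2 n :
  n%:R * eisenstein (- 24) 1 n =
  12^-1 * (\sum_(i < n.+1) eisenstein (- 24) 1 i * eisenstein (- 24) 1 (n - i)
           - eisenstein 240 3 n).
Proof.
case: n => [|n]; first by rewrite big_ord1 /eisenstein /=; ring.
rewrite eisenstein_cauchy // /eisenstein /=.
have -> : sigma_conv n.+1 1 1 = (2 * sigma_conv n.+1 1 1) / 2 by field.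
by rewrite sigma_conv_1_1 //; field.
Qed.

Lemma ramanujan_E4 n :
  n%:R * eisenstein 240 3 n =
  3^-1 * (\sum_(i < n.+1) eisenstein (- 24) 1 i * eisenstein 240 3 (n - i)
           - eisenstein (- 504) 5 n).
Proof.
case: n => [|n]; first by rewrite big_ord1 /eisenstein /=; ring.
rewrite eisenstein_cauchy // /eisenstein /=.
have -> : sigma_conv n.+1 1 3 = (8 * sigma_conv n.+1 1 3) / 8 by field.
by rewrite sigma_conv_1_3 //; field.
Qed.

(** The cube of the quadratic form gives only a combination of two convolutions;
    the evaluation of sigma_3 * sigma_3 separates them. *)
Lemma ramanujan_E6 n :
  n%:R * eisenstein (- 504) 5 n =
  2^-1 * (\sum_(i < n.+1) eisenstein (- 24) 1 i * eisenstein (- 504) 5 (n - i)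
          - \sum_(i < n.+1) eisenstein 240 3 i * eisenstein 240 3 (n - i)).
Proof.
case: n => [|n]; first by rewrite !big_ord1 /eisenstein /=; ring.
rewrite !eisenstein_cauchy // /eisenstein /=.
have -> : sigma_conv n.+1 1 5 = (12 * sigma_conv n.+1 1 5 + 14 * sigma_conv n.+1 3 3
    - 14 * sigma_conv n.+1 3 3) / 12 by field.
rewrite sigma_conv_1_5_3_3 //.
have -> : sigma_conv n.+1 3 3 = (4 * sigma_conv n.+1 3 3) / 4 by field.
by rewrite sigma_conv_3_3 //; field.
Qed.

End ConvolutionSums.

(** * Eventually constant sums and integer binomial coefficients *)

Section FiniteSum.
Variables (C : fieldType) (V : lmodType C).
Implicit Types (u v : nat -> V) (x y : V).

Lemma finite_sum_vanish u N : (forall i, (N <= i)%N -> u i = 0) ->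
  finite_sum u (\sum_(i < N) u i).
Proof.
move=> u0; exists N => M /subnKC <-; rewrite big_split_ord /=.
by rewrite [X in _ + X]big1 ?addr0 // => i _; rewrite u0 // leq_addr.
Qed.

Lemma finite_sum_uniq u x y : finite_sum u x -> finite_sum u y -> x = y.
Proof.
move=> [N uN] [M uM]; rewrite -(uN (maxn N M)) ?leq_maxl //.
by rewrite uM // leq_maxr.
Qed.

Lemma eq_finite_sum u v x : u =1 v -> finite_sum u x -> finite_sum v x.
Proof.
move=> uv [N uN]; exists N => M /uN <-.
by apply: eq_bigr => i _; rewrite uv.
Qed.

Lemma finite_sumB u v x y : finite_sum u x -> finite_sum v y ->
  finite_sum (fun i => u i - v i) (x - y).
Proof.
move=> [N uN] [M vM]; exists (maxn N M) => K; rewrite geq_max => /andP[NK MK].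
by rewrite sumrB uN // vM.
Qed.

Definition shift_seq u i := if i is j.+1 then u j else 0.

Lemma finite_sum_shift u x : finite_sum u x -> finite_sum (shift_seq u) x.
Proof.
move=> [N uN]; exists N.+1 => -[|M] // NM.
by rewrite big_ord_recl /= add0r -(uN M).
Qed.

End FiniteSum.

Section GeneralizedBinomial.
Variable C : numFieldType.

Lemma zbinom0 (r : int) : zbinom C r 0 = 1.
Proof. by rewrite /zbinom big_ord0 fact0 divr1. Qed.

Lemma zbinomS (r : int) i :
  zbinom C r i.+1 = zbinom C r i * (r - i%:Z)%:~R / i.+1%:R.
Proof.
rewrite /zbinom big_ord_recr /= factS natrM; field.
by rewrite nat1r !pnatr_eq0 /= -lt0n fact_gt0.
Qed.

(** Pascal's rule drives the recursion between the Borcherds identities. *)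
Lemma zbinom_pascal (r : int) i :
  zbinom C (r + 1) i.+1 = zbinom C r i.+1 + zbinom C r i.
Proof.
elim: i => [|i IH]; first by rewrite !zbinomS !zbinom0 !rmorphD rmorphN /=; field.
rewrite zbinomS IH [zbinom C r i.+2]zbinomS [zbinom C r i.+1]zbinomS.
rewrite !rmorphB !rmorphD /= -!natr1 -!pmulrn -!natr1; field.
by rewrite !natr1 !pnatr_eq0.
Qed.

Lemma zbinom_nat (n : nat) i : zbinom C n i = 'C(n, i)%:R.
Proof.
elim: i => [|i IH]; first by rewrite zbinom0 bin0.
rewrite zbinomS IH; have [le_in|lt_ni] := leqP i n.
  rewrite subzn // -pmulrn -natrM mulnC -mul_bin_left natrM mulrAC divff ?mul1r //.
  by rewrite pnatr_eq0.
by rewrite !bin_small ?mul0r // ltnW.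
Qed.

Lemma zbinom_neg (u i : nat) :
  (-1) ^+ i * zbinom C (Negz u) i = 'C(u + i, i)%:R.
Proof.
elim: i => [|i IH]; first by rewrite zbinom0 bin0 mulr1.
have -> : 'C(u + i.+1, i.+1)%:R = 'C(u + i, i)%:R * (u + i).+1%:R / i.+1%:R :> C.
  rewrite -natrM mulnC addnS (mul_bin_diag (u + i).+1) natrM mulrAC divff ?mul1r //.
  by rewrite pnatr_eq0.
rewrite -IH zbinomS NegzE exprS rmorphB rmorphN /= -!pmulrn -!natr1 natrD; field.
by rewrite natr1 pnatr_eq0.
Qed.

End GeneralizedBinomial.

(** * Commutative algebras with a derivation are vertex algebras *)

Section HolomorphicVertexAlgebra.
Variables (C : numFieldType) (A : comAlgType C) (D : {linear A -> A}).
Hypothesis DM : forall a b, D (a * b) = D a * b + a * D b.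
Implicit Types (a b c : A) (r s t m : int) (n i j : nat).

Definition divided_power n a : A := (n`!)%:R^-1 *: iter n D a.

Lemma iter_linear n : linear (iter n D).
Proof. by elim: n => [|n IH] k a b //=; rewrite IH linearP. Qed.

Lemma divided_power_linear n : linear (divided_power n).
Proof.
by move=> k a b; rewrite /divided_power iter_linear scalerDr !scalerA mulrC.
Qed.
HB.instance Definition _ n :=
  GRing.isLinear.Build C A A *:%R (divided_power n) (divided_power_linear n).

Lemma divided_power0 a : divided_power 0 a = a.
Proof. by rewrite /divided_power fact0 invr1 scale1r. Qed.

Lemma divided_powerS n a :
  D (divided_power n a) = n.+1%:R *: divided_power n.+1 a.
Proof.
rewrite /divided_power linearZ /= scalerA factS natrM invfM mulrA divff ?mul1r //.
by rewrite pnatr_eq0.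
Qed.

(** Leibniz's rule has no binomial coefficients when written for D^n / n!. *)
Lemma divided_powerM n a b :
  divided_power n (a * b) =
  \sum_(i < n.+1) divided_power i a * divided_power (n - i) b.
Proof.
elim: n => [|n IH].
  by rewrite big_ord_recl big_ord0 addr0 !divided_power0.
apply: (scalerI (a := n.+1%:R)); first by rewrite pnatr_eq0.
rewrite -divided_powerS IH linear_sum /=.
under eq_bigr => i _ do rewrite DM !divided_powerS.
rewrite big_split /= scaler_sumr.
transitivity (\sum_(i < n.+2) (i%:R *: (divided_power i a * divided_power (n.+1 - i) b)
  + (n.+1 - i)%:R *: (divided_power i a * divided_power (n.+1 - i) b))).
  rewrite big_split /=; congr (_ + _).
    rewrite [RHS]big_ord_recl scale0r add0r; apply: eq_bigr => i _.
    by rewrite lift0 subSS scalerAl.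
  rewrite [RHS]big_ord_recr /= subnn scale0r addr0; apply: eq_bigr => i _.
  by rewrite scalerAr subSn // -ltnS.
apply: eq_bigr => i _; rewrite -scalerDl -natrD subnKC //.
by rewrite -ltnS.
Qed.

Lemma divided_power_comp i j a :
  divided_power i (divided_power j a) = 'C(i + j, i)%:R *: divided_power (i + j) a.
Proof.
elim: i => [|i IH]; first by rewrite divided_power0 bin0 scale1r.
apply: (scalerI (a := i.+1%:R)); first by rewrite pnatr_eq0.
rewrite -divided_powerS IH linearZ /= divided_powerS !scalerA -!natrM.
by rewrite mulnC addSn mul_bin_diag.
Qed.

(** The mode a(m) of Y(a, z) = e^(zD) a is multiplication by [mode m a]. *)
Definition mode m a : A :=
  match m with Posz _ => 0 | Negz n => divided_power n a end.

Lemma mode_linear m : linear (mode m).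
Proof.
by case: m => n k a b; [rewrite scaler0 addr0|exact: divided_power_linear].
Qed.
HB.instance Definition _ m :=
  GRing.isLinear.Build C A A *:%R (mode m) (mode_linear m).

Lemma mode_ge0 m a : 0 <= m -> mode m a = 0.
Proof. by case: m. Qed.

(** The Borcherds identity is split into its three sums, each of which converges
    separately; the third vector c is a common factor and is left out. *)
Let lhs a b r s t i : A := zbinom C r i *: mode (r + s - i%:Z) (mode (t + i%:Z) a * b).
Let rhs1 a b r s t i : A :=
  ((-1) ^+ i * zbinom C t i) *: (mode (r + t - i%:Z) a * mode (s + i%:Z) b).
Let rhs2 a b r s t i : A :=
  ((-1) ^+ i * zbinom C t i * (-1) ^ t) *: (mode (s + t - i%:Z) b * mode (r + i%:Z) a).

Let vanishing (T : nat -> A) := exists N, forall i, (N <= i)%N -> T i = 0.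

Let lhs_vanish a b r s t : vanishing (lhs a b r s t).
Proof.
exists `|t|%N => i ti; rewrite /lhs [mode (t + _) a]mode_ge0 ?mul0r ?linear0 ?scaler0 //; lia.
Qed.
Let rhs1_vanish a b r s t : vanishing (rhs1 a b r s t).
Proof.
exists `|s|%N => i ti; rewrite /rhs1 [mode (s + _) b]mode_ge0 ?mulr0 ?scaler0 //; lia.
Qed.
Let rhs2_vanish a b r s t : vanishing (rhs2 a b r s t).
Proof.
exists `|r|%N => i ti; rewrite /rhs2 [mode (r + _) a]mode_ge0 ?mulr0 ?scaler0 //; lia.
Qed.
Let vanish_sum T : vanishing T -> exists x, finite_sum T x.
Proof. by case=> N TN; exists (\sum_(i < N) T i); exact: finite_sum_vanish. Qed.

Definition borcherds a b r s t := forall x y z,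
  finite_sum (lhs a b r s t) x -> finite_sum (rhs1 a b r s t) y ->
  finite_sum (rhs2 a b r s t) z -> x = y - z.

(** For t >= 0 the left side is zero termwise, and the substitution i |-> t - i
    exchanges the two sums on the right. *)
Lemma borcherds_nat a b r s n : borcherds a b r s (n : nat).
Proof.
move=> x y z lx ly lz.
have -> : x = 0.
  apply: finite_sum_uniq lx _; exists 0%N => M _; apply: big1 => i _.
  by rewrite /lhs [mode (_ + _) a]mode_ge0 ?mul0r ?linear0 ?scaler0.
have small i : (n.+1 <= i)%N -> zbinom C n i = 0.
  by move=> ni; rewrite zbinom_nat bin_small.
have -> : y = \sum_(i < n.+1) rhs1 a b r s n i.
  apply: finite_sum_uniq ly (finite_sum_vanish _) => i ni.
  by rewrite /rhs1 small // mulr0 scale0r.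
have -> : z = \sum_(i < n.+1) rhs2 a b r s n i.
  apply: finite_sum_uniq lz (finite_sum_vanish _) => i ni.
  by rewrite /rhs2 small // mulr0 mul0r scale0r.
apply/esym/eqP; rewrite subr_eq0; apply/eqP.
rewrite (reindex_inj rev_ord_inj) /=; apply: eq_bigr => i _.
have le_in : (i <= n)%N by rewrite -ltnS.
rewrite /rhs1 /rhs2 subSS !zbinom_nat bin_sub // mulrC; congr (_ *: _).
  rewrite -exprnP -signr_odd oddB // -[in RHS]signr_odd -[(-1) ^+ n]signr_odd.
  by case: (odd n); case: (odd i); rewrite /= ?expr0 ?expr1; ring.
by rewrite mulrC; congr (mode _ _ * mode _ _); lia.
Qed.

(** For r = 0 and s = - m - 1 the left side is D^m (D^u a / u! * b) / m!, and the
    identity is its expansion by Leibniz's rule; for s >= 0 both sides vanish. *)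
Lemma borcherds_r0 a b s u : borcherds a b 0 s (Negz u).
Proof.
move=> x y z lx ly lz.
have -> : x = mode s (mode (Negz u) a * b).
  apply: finite_sum_uniq lx _; exists 1%N => -[//|M] _.
  rewrite big_ord_recl big1 => [|i _].
    by rewrite /lhs zbinom0 scale1r addr0 add0r subr0 addr0.
  rewrite /lhs /zbinom big_ord_recl /= subr0 mul0r mul0r scale0r //.
have -> : z = 0.
  apply: finite_sum_uniq lz _; exists 0%N => M _; apply: big1 => i _.
  by rewrite /rhs2 [mode (_ + _) a]mode_ge0 ?mulr0 ?scaler0.
rewrite subr0; apply: (finite_sum_uniq _ ly) => {x y z lx ly lz}.
case: s => m.
  exists 0%N => M _; apply: big1 => i _.
  by rewrite /rhs1 [mode (_ + _) b]mode_ge0 ?mulr0 ?scaler0.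
have -> : mode (Negz m) (mode (Negz u) a * b) =
    \sum_(i < m.+1) rhs1 a b 0 (Negz m) (Negz u) i.
  rewrite /= divided_powerM; apply: eq_bigr => i _.
  rewrite /rhs1 zbinom_neg divided_power_comp -scalerAl addnC add0r.
  have -> : Negz u - i%:Z = Negz (u + i) by lia.
  have -> : Negz m + i%:Z = Negz (m - i) by have := ltn_ord i; lia.
  by [].
apply: finite_sum_vanish => i mi.
by rewrite /rhs1 [mode (_ + _) b]mode_ge0 ?mulr0 ?scaler0 //; lia.
Qed.

(** Termwise form of the recursion: the shift of the index comes from the second
    summand of Pascal's rule. *)
Let lhs_pascal a b r s t i :
  lhs a b r (s + 1) t i = lhs a b (r + 1) s t i - shift_seq (lhs a b r s (t + 1)) i.
Proof.
rewrite /lhs; case: i => [|i] /=.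
  by rewrite !subr0 !zbinom0 (_ : r + (s + 1) = r + 1 + s) //; ring.
rewrite zbinom_pascal scalerDl.
have -> : r + (s + 1) - i.+1%:Z = r + s - i%:Z by lia.
have -> : r + 1 + s - i.+1%:Z = r + s - i%:Z by lia.
have -> : t + 1 + i%:Z = t + i.+1%:Z by lia.
by rewrite addrK.
Qed.

Let rhs1_pascal a b r s t i :
  rhs1 a b r s (t + 1) i = rhs1 a b (r + 1) s t i - shift_seq (rhs1 a b r (s + 1) t) i.
Proof.
rewrite /rhs1; case: i => [|i] /=.
  by rewrite !subr0 !zbinom0 (_ : r + (t + 1) = r + 1 + t) //; ring.
rewrite zbinom_pascal mulrDr scalerDl.
have -> : r + (t + 1) - i.+1%:Z = r + t - i%:Z by lia.
have -> : r + 1 + t - i.+1%:Z = r + t - i%:Z by lia.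
have -> : s + 1 + i%:Z = s + i.+1%:Z by lia.
have -> : (-1) ^+ i.+1 * zbinom C t i = - ((-1) ^+ i * zbinom C t i).
  by rewrite exprS; ring.
by rewrite scaleNr.
Qed.

Let rhs2_pascal a b r s t i :
  rhs2 a b r s (t + 1) i = shift_seq (rhs2 a b (r + 1) s t) i - rhs2 a b r (s + 1) t i.
Proof.
have sgn : (-1) ^ (t + 1) = - (-1) ^ t :> C.
  by rewrite expfzDr ?oppr_eq0 ?oner_eq0 // expr1z mulrN1.
rewrite /rhs2 sgn; case: i => [|i] /=.
  rewrite !subr0 !zbinom0 sub0r -scaleNr (_ : s + (t + 1) = s + 1 + t); last by ring.
  by congr (_ *: _); ring.
rewrite zbinom_pascal.
have -> : s + (t + 1) - i.+1%:Z = s + t - i%:Z by lia.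
have -> : s + 1 + t - i.+1%:Z = s + t - i%:Z by lia.
have -> : r + 1 + i%:Z = r + i.+1%:Z by lia.
by rewrite -scalerBl; congr (_ *: _); rewrite exprS; ring.
Qed.

(** Each of the three sums S satisfies the same linear relation
    S(r, s, t + 1) = S(r + 1, s, t) - S(r, s + 1, t). *)
Lemma borcherds_step a b r s t : borcherds a b r s (t + 1) ->
  borcherds a b (r + 1) s t <-> borcherds a b r (s + 1) t.
Proof.
move=> B3.
have [x1 l1] := vanish_sum (lhs_vanish a b (r + 1) s t).
have [y1 m1] := vanish_sum (rhs1_vanish a b (r + 1) s t).
have [z1 n1] := vanish_sum (rhs2_vanish a b (r + 1) s t).
have [x2 l2] := vanish_sum (lhs_vanish a b r (s + 1) t).
have [y2 m2] := vanish_sum (rhs1_vanish a b r (s + 1) t).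
have [z2 n2] := vanish_sum (rhs2_vanish a b r (s + 1) t).
have [x3 l3] := vanish_sum (lhs_vanish a b r s (t + 1)).
have [y3 m3] := vanish_sum (rhs1_vanish a b r s (t + 1)).
have [z3 n3] := vanish_sum (rhs2_vanish a b r s (t + 1)).
have E3 := B3 _ _ _ l3 m3 n3.
have Ex : x2 = x1 - x3.
  apply: finite_sum_uniq l2 _; apply: eq_finite_sum (finite_sumB l1 (finite_sum_shift l3)).
  by move=> i; rewrite lhs_pascal.
have Ey : y3 = y1 - y2.
  apply: finite_sum_uniq m3 _; apply: eq_finite_sum (finite_sumB m1 (finite_sum_shift m2)).
  by move=> i; rewrite rhs1_pascal.
have Ez : z3 = z1 - z2.
  apply: finite_sum_uniq n3 _; apply: eq_finite_sum (finite_sumB (finite_sum_shift n1) n2).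
  by move=> i; rewrite rhs2_pascal.
split=> B x y z lx my nz.
  rewrite (finite_sum_uniq lx l2) (finite_sum_uniq my m2) (finite_sum_uniq nz n2).
  by rewrite Ex E3 (B _ _ _ l1 m1 n1) Ey Ez; ring.
rewrite (finite_sum_uniq lx l1) (finite_sum_uniq my m1) (finite_sum_uniq nz n1).
have -> : x1 = x2 + x3 by rewrite Ex subrK.
by rewrite E3 (B _ _ _ l2 m2 n2) Ey Ez; ring.
Qed.

(** Inside the plane of a fixed t the step moves along the lines on which r + s is
    constant, and each such line meets r = 0. *)
Lemma borcherds_descent a b t : (forall r s, borcherds a b r s (t + 1)) ->
  (forall s, borcherds a b 0 s t) -> forall r s, borcherds a b r s t.
Proof.
move=> next base; case=> n.
  elim: n => [|n IH] s; first exact: base.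
  have -> : Posz n.+1 = n%:Z + 1 by lia.
  by apply/(borcherds_step (next _ _))/IH.
have down r : (forall s, borcherds a b (r + 1) s t) -> forall s, borcherds a b r s t.
  move=> H s; rewrite -(subrK 1 s).
  by apply/(borcherds_step (next _ _))/H.
elim: n => [|n IH]; apply: down; first exact: base.
by have -> : Negz n.+1 + 1 = Negz n by lia.
Qed.

Lemma borcherds_identity a b r s t : borcherds a b r s t.
Proof.
case: t => [n|u]; first exact: borcherds_nat.
elim: u r s => [|u IH]; apply: borcherds_descent.
- by move=> r s; exact: (@borcherds_nat _ _ _ _ 0).
- by move=> s; exact: borcherds_r0.
- by have -> : Negz u.+1 + 1 = Negz u by lia.
- by move=> s; exact: borcherds_r0.
Qed.

Lemma finite_sum_mulr (T : nat -> A) x c : finite_sum T x ->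
  finite_sum (fun i => T i * c) (x * c).
Proof. by move=> [N TN]; exists N => M /TN <-; rewrite mulr_suml. Qed.

(** All modes are multiplication operators, so the third vector c of the Borcherds
    identity factors out of every term. *)
Theorem holomorphic_vertex_algebra (prod : A -> int -> A -> A) :
  (forall a m b, prod a m b = mode m a * b) -> is_vertex_algebra prod 1.
Proof.
move=> prodE; split.
- by move=> m b k a a'; rewrite !prodE linearP mulrDl scalerAl.
- by move=> a m k b b'; rewrite !prodE mulrDr scalerAr.
- exact: oner_neq0.
- by move=> a b; exists 0 => m /mode_ge0 m0; rewrite prodE m0 mul0r.
- by move=> a m /mode_ge0 m0; rewrite prodE m0 mul0r.
- by move=> a; rewrite prodE mulr1 /= divided_power0.
move=> a b c r s t.
have [x lx] := vanish_sum (lhs_vanish a b r s t).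
have [y my] := vanish_sum (rhs1_vanish a b r s t).
have [z nz] := vanish_sum (rhs2_vanish a b r s t).
exists (x * c); split.
  by apply: eq_finite_sum (finite_sum_mulr c lx) => i; rewrite !prodE /lhs -scalerAl.
rewrite (borcherds_identity lx my nz).
apply: eq_finite_sum (finite_sum_mulr c (finite_sumB my nz)) => i.
by rewrite !prodE /rhs1 /rhs2 mulrBl -!scalerAl scalerBr scalerA !mulrA.
Qed.

Lemma mode_derivation m a : D (mode m a) = mode m (D a).
Proof.
case: m => n /=; first by rewrite linear0.
by rewrite /divided_power linearZ -iterSr -iterS.
Qed.

Lemma derivation_mode m a : D (mode m a) = - (m%:~R *: mode (m - 1) a).
Proof.
case: m => [[|n]|n].
- by rewrite /= linear0 scale0r oppr0.
- by rewrite [mode (_ - _) a]mode_ge0 ?scaler0 ?oppr0 ?linear0 //; lia.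
have -> : Negz n - 1 = Negz n.+1 by lia.
by rewrite /= divided_powerS NegzE rmorphN /= scaleNr opprK.
Qed.

(** Moving L past D^n costs 2 E at each of the n steps, with eigenvalues k, ...,
    k + n - 1 of E; their sum n (2 k + n - 1) / 2 explains the coefficient. *)
Lemma lowering_mode (L E : {linear A -> A}) (k : int) a m :
  (forall x, L (D x) - D (L x) = 2 *: E x) ->
  (forall n, E (divided_power n a) = (k + n%:Z)%:~R *: divided_power n a) ->
  L (mode m a) = mode m (L a) + (2 * k - m - 2)%:~R *: mode (m + 1) a.
Proof.
move=> LD Ea; case: m => n.
  by rewrite [mode (_ + 1) a]mode_ge0 ?addr_ge0 // scaler0 addr0 /= linear0.
elim: n => [|n IH].
  rewrite [mode (_ + 1) a]mode_ge0 // scaler0 addr0.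
  by rewrite -![mode (-1)%Z _]/(divided_power 0 _) !divided_power0.
have DM1 : D (mode (Negz n + 1) a) = n%:R *: divided_power n a.
  (* for n = 0 the mode on the left is a(0) = 0 and the coefficient vanishes *)
  case: n {IH} => [|n]; first by rewrite mode_ge0 // scale0r linear0.
  have -> : Negz n.+1 + 1 = Negz n by lia.
  by rewrite -[mode _ _]/(divided_power n a) divided_powerS.
have -> : Negz n.+1 + 1 = Negz n by lia.
apply: (scalerI (a := n.+1%:R)); first by rewrite pnatr_eq0.
have Lstep : n.+1%:R *: L (divided_power n.+1 a) =
    D (L (divided_power n a)) + 2 *: ((k + n%:Z)%:~R *: divided_power n a).
  by rewrite -Ea -LD [RHS]addrC subrK divided_powerS [RHS]linearZZ.
rewrite [LHS]Lstep; have {}IH : L (divided_power n a) = divided_power n (L a) +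
  (2 * k - Negz n - 2)%:~R *: mode (Negz n + 1) a := IH.
rewrite IH linearD [D (_ *: mode _ _)]linearZZ DM1 /= divided_powerS.
rewrite scalerDr !scalerA -addrA -scalerDl.
congr (_ + _ *: _).
rewrite !NegzE !(rmorphB, rmorphD, rmorphN, rmorphM) /= -!pmulrn -!natr1.
by ring.
Qed.

End HolomorphicVertexAlgebra.

(** * Polynomial vector fields and the weight grading *)

Section VectorFields.
Variables (F : fieldType) (n : nat).
Local Notation Q := {mpoly F[n]}.
Implicit Types (f g : Q) (v : 'I_n -> Q).

(** Identities between algebra morphisms, derivations and commutators of
    derivations pass from the generators to all polynomials by this induction. *)
Lemma mpoly_alg_ind (P : Q -> Prop) :
  (forall c, P c%:MP) -> (forall i, P 'X_i) ->
  (forall f g, P f -> P g -> P (f + g)) -> (forall f g, P f -> P g -> P (f * g)) ->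
  forall f, P f.
Proof.
move=> PC PX PD PM f; rewrite (mpolyE f).
apply: big_ind => [||m _]; [by rewrite -(mpolyC0 n F); exact: PC|exact: PD|].
rewrite -mul_mpolyC; apply: (PM) => //; rewrite mpolyXE_id.
apply: big_ind => [||i _]; [by rewrite -(mpolyC1 n F); exact: PC|exact: PM|].
by elim: (m i) => [|k IH]; rewrite ?expr0 ?exprS -?(mpolyC1 n F) //; exact: PM.
Qed.

Definition vector_field v f : Q := \sum_i v i * mderiv i f.

Lemma vector_field_linear v : linear (vector_field v).
Proof.
move=> c f g; rewrite scaler_sumr -big_split; apply: eq_bigr => i _.
by rewrite linearP mulrDr scalerAr.
Qed.
HB.instance Definition _ v :=
  GRing.isLinear.Build F Q Q *:%R (vector_field v) (vector_field_linear v).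

Lemma vector_fieldM v f g :
  vector_field v (f * g) = vector_field v f * g + f * vector_field v g.
Proof.
rewrite mulr_suml mulr_sumr -big_split; apply: eq_bigr => i _ /=.
by rewrite mderivM; ring.
Qed.

Lemma vector_fieldX v i : vector_field v 'X_i = v i.
Proof.
rewrite /vector_field (bigD1 i) //= mderivX mnm1E eqxx scale1r big1 => [|j ji].
  by rewrite -[X in (X - _)%MM]add0m addmK mpolyX0 mulr1 addr0.
by rewrite mderivX mnm1E eq_sym (negbTE ji) scale0r mulr0.
Qed.

Lemma vector_fieldC v c : vector_field v c%:MP = 0.
Proof. by rewrite /vector_field big1 // => i _; rewrite mderivC mulr0. Qed.

(** The commutator of two derivations is a derivation, hence is determined by its
    values on the variables. *)
Lemma vector_field_commutator u v w (c : F) :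
  (forall i, vector_field u (v i) - vector_field v (u i) = c *: w i) ->
  forall f, vector_field u (vector_field v f) - vector_field v (vector_field u f)
    = c *: vector_field w f.
Proof.
move=> uvw; elim/mpoly_alg_ind => [a|i|f g Pf Pg|f g Pf Pg].
- by rewrite !vector_fieldC !linear0 addr0.
- by rewrite !vector_fieldX.
- by rewrite [vector_field w _]linearD scalerDr -Pf -Pg !linearD /=; ring.
rewrite !vector_fieldM linearD [vector_field v (_ + _)]linearD /=.
rewrite !vector_fieldM scalerDr scalerAl scalerAr -Pf -Pg.
by ring.
Qed.

(** Stated with an equation between the weights so that one lemma serves fields
    that raise the weight and fields that lower it. *)
Lemma vector_field_homog v (d e k : nat) f (i : 'I_n) :
  (k + i.+1 = e + d)%N -> (f \is d.-homog for @mnmwgt n) ->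
  (v i \is e.-homog for @mnmwgt n) -> (v i * mderiv i f \is k.-homog for @mnmwgt n).
Proof.
move=> kE fd ve; rewrite (mpolyE f) linear_sum mulr_sumr /= big_seq.
apply: rpred_sum => m /(dhomog_mf fd) md.
rewrite linearZ /= mderivX -!scalerAr; apply/rpredZ.
have [->|m0] := eqVneq (m i) 0%N; first by rewrite scale0r rpred0.
have mK : (m - U_(i) + U_(i))%MM = m.
  by apply/submK/mnm_lepP => j; rewrite mnm1E; case: eqP => // <-; rewrite lt0n.
apply/rpredZ; have -> : k = (e + mnmwgt (m - U_(i))%MM)%N.
  by apply/eqP; rewrite -(eqn_add2r i.+1) kE -addnA -(mnmwgt1 i) -mnmwgtD mK md.
by apply: dhomogM => //; rewrite dhomogX.
Qed.

Lemma vector_field_shift v (d k : nat) f :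
  (f \is d.-homog for @mnmwgt n) ->
  (forall i, (v i \is (i.+1 + k).-homog for @mnmwgt n)) ->
  (vector_field v f \is (d + k).-homog for @mnmwgt n).
Proof.
move=> fd vk; apply: rpred_sum => i _; apply: vector_field_homog fd (vk i).
by lia.
Qed.

Lemma mderiv_homog (d : nat) f (i : 'I_n) : (i < d)%N -> (f \is d.-homog for @mnmwgt n) ->
  (mderiv i f \is (d - i.+1).-homog for @mnmwgt n).
Proof.
move=> id fd; rewrite -[mderiv i f]mul1r.
by apply: (vector_field_homog (v := fun=> 1)) fd (dhomog1 _ _); rewrite subnK.
Qed.

Lemma mderiv_homog_small (d : nat) f (i : 'I_n) : (d <= i)%N -> (f \is d.-homog for @mnmwgt n) ->
  mderiv i f = 0.
Proof.
move=> di fd; rewrite (mpolyE f) linear_sum /= big_seq big1 // => m /(dhomog_mf fd) md.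
rewrite linearZ /= mderivX; have [->|m0] := eqVneq (m i) 0%N; first by rewrite scale0r scaler0.
have {}md : mnmwgt m = d := md.
move: md; rewrite /mnmwgt (bigD1 i) //= => md.
have : (i.+1 <= m i * i.+1)%N by rewrite leq_pmull // lt0n.
lia.
Qed.

Definition euler_field (i : 'I_n) : Q := i.+1%:R *: 'X_i.

Lemma euler_fieldE f : vector_field euler_field f =
  \sum_(m <- msupp f) ((mnmwgt m)%:R * f@_m) *: 'X_[m].
Proof.
rewrite {1}(mpolyE f) linear_sum; apply: eq_bigr => m _.
rewrite linearZ mulrC -scalerA; congr (_ *: _).
rewrite /vector_field /mnmwgt natr_sum scaler_suml; apply: eq_bigr => i _.
rewrite mderivX -scalerAl -scalerAr scalerA natrM mulrC.
have [->|m0] := eqVneq (m i) 0%N; first by rewrite !mul0r !scale0r.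
rewrite -mpolyXD addmC submK //.
by apply/mnm_lepP => j; rewrite mnm1E; case: eqP => // <-; rewrite lt0n.
Qed.

Lemma euler_field_homog d f : (f \is d.-homog for @mnmwgt n) ->
  vector_field euler_field f = d%:R *: f.
Proof.
move=> fd; rewrite euler_fieldE [in RHS](mpolyE f) scaler_sumr big_seq [RHS]big_seq.
by apply: eq_bigr => m /(dhomog_mf fd) ->; rewrite scalerA.
Qed.

Lemma homog_finite_dim d : finite_dimensional (fun f : Q => (f \is d.-homog for @mnmwgt n)).
Proof.
pose ms := [seq val m | m <- enum {: 'X_{1..n < d.+1}} & mnmwgt (val m) == d].
exists [seq 'X_[m] | m <- ms].
  move=> u /mapP[_ /mapP[m +] -> ->]; rewrite mem_filter => /andP[md _].
  by rewrite dhomogX.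
move=> f fd; exists (fun i => f@_(nth 0%MM ms i)).
rewrite size_map; transitivity (\sum_(m <- ms) f@_m *: 'X_[m]).
  rewrite big_map big_filter big_enum_cond /=.
  have lt : (msize f <= d.+1)%N.
    by apply/bigmax_leqP_seq => m /(dhomog_mf fd) <- _; rewrite ltnS leq_mdeg_mnmwgt.
  rewrite [LHS](mpolywE lt) (bigID (fun m : 'X_{1..n < d.+1} => mnmwgt m == d)) /=.
  rewrite [X in _ + X]big1 ?addr0 // => m md.
  by rewrite (dhomog_nemf_coeff fd md) scale0r.
rewrite (big_nth 0%MM) big_mkord; apply: eq_bigr => i _.
by rewrite (nth_map 0%MM).
Qed.

End VectorFields.

(** * The sl2-triple of quasi-modular forms *)

Section RamanujanField.
Variable F : numFieldType.
Local Notation Q := {mpoly F[3]}.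

Definition ix2 : 'I_3 := ord0.
Definition ix4 : 'I_3 := @Ordinal 3 1 isT.
Definition ix6 : 'I_3 := @Ordinal 3 2 isT.

Lemma ord3_ind (P : 'I_3 -> Prop) : P ix2 -> P ix4 -> P ix6 -> forall i, P i.
Proof.
by move=> P0 P1 P2 [[|[|[|//]]] lt];
  [move: P0|move: P1|move: P2]; congr P; apply: val_inj.
Qed.

(** The right hand sides of Ramanujan's differential equations. *)
Definition ramanujan (i : 'I_3) : Q :=
  match val i with
  | 0 => 12^-1 *: ('X_ix2 * 'X_ix2 - 'X_ix4)
  | 1 => 3^-1 *: ('X_ix2 * 'X_ix4 - 'X_ix6)
  | _ => 2^-1 *: ('X_ix2 * 'X_ix6 - 'X_ix4 * 'X_ix4)
  end.

(** The field 12 d/dE_2 that represents L(1) = - delta. *)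
Definition lowering (i : 'I_3) : Q := if val i == 0%N then 12%:MP else 0.

Lemma X_homog (i : 'I_3) : ('X_i : Q) \is (i.+1).-homog for @mnmwgt 3.
Proof. by rewrite dhomogX; apply/eqP; exact: mnmwgt1. Qed.

Lemma ramanujan_homog i : ramanujan i \is (i.+1 + 1).-homog for @mnmwgt 3.
Proof.
by elim/ord3_ind: i; rewrite /ramanujan /=; apply/rpredZ/rpredB;
  rewrite ?X_homog //; apply: (dhomogM (X_homog _) (X_homog _)).
Qed.

Lemma lowering_euler f :
  vector_field lowering (vector_field (euler_field F (n := 3)) f)
  - vector_field (euler_field F (n := 3)) (vector_field lowering f)
  = 1 *: vector_field lowering f.
Proof.
apply: vector_field_commutator; elim/ord3_ind.
all: rewrite /euler_field !linearZ /= vector_fieldX /lowering /=.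
all: by rewrite ?vector_fieldC ?[vector_field _ 0]linear0 ?scaler0 subr0.
Qed.

Lemma euler_ramanujan f :
  vector_field (euler_field F (n := 3)) (vector_field ramanujan f)
  - vector_field ramanujan (vector_field (euler_field F (n := 3)) f)
  = 1 *: vector_field ramanujan f.
Proof.
apply: vector_field_commutator => i; rewrite (euler_field_homog (ramanujan_homog i)).
rewrite /euler_field linearZ /= vector_fieldX -scalerBl natrD.
by congr (_ *: _); ring.
Qed.

Lemma lowering_ramanujan f :
  vector_field lowering (vector_field ramanujan f)
  - vector_field ramanujan (vector_field lowering f)
  = 2 *: vector_field (euler_field F (n := 3)) f.
Proof.
have X12 (c : F) (p : Q) : c *: (12%:MP * p) = (c * 12) *: p.
  by rewrite mul_mpolyC scalerA.
apply: vector_field_commutator; elim/ord3_ind.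
all: rewrite {1}/ramanujan {2}/lowering /euler_field /= ?vector_fieldC ?[vector_field _ 0]linear0 subr0.
all: rewrite linearZ /= linearB /= !vector_fieldM !vector_fieldX /lowering /=.
all: rewrite ?mul0r ?mulr0 ?addr0 ?subr0 ?oppr0 ?addr0 ?(mulrC _ 12%:MP) -?mulrDr X12.
all: rewrite -?mulr2n -?scaler_nat !scalerA; congr (_ *: _).
all: by field.
Qed.

End RamanujanField.

Section HalfGrading.
Variable R : realType.
Local Notation C := (R[i]).
Local Notation Q := {mpoly C[3]}.
Implicit Types (f g : Q).

(** Weights are read off monomials, so homogeneous components of different
    weights have disjoint supports. *)
Lemma half_grading_direct : is_direct_grading (@half_grading R).
Proof.
split.
- by case=> n /=; rewrite ?rpred0.
- move=> [d|n] c u v /=; first by move=> ud vd; rewrite rpredD ?rpredZ.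
  by move=> -> ->; rewrite scaler0 addr0.
- move=> v; pose k := mmeasure (@mnmwgt 3) v.
  exists [seq Posz d | d <- iota 0 k].
  exists (fun m => if m is Posz d then pihomog (@mnmwgt 3) d v else 0); split.
    by case=> d //=; exact: pihomogP.
  by rewrite big_map -{1}[k]subn0 -/(index_iota 0 k) big_mkord -pihomog_partitionE.
move=> s x us xg x0 [d|n] ns; last exact: (xg (Negz n)).
apply/mpolyP => m; rewrite mcoeff0.
have [md|md] := eqVneq (mnmwgt m) d; last exact: (dhomog_nemf_coeff (xg (Posz d)) md).
have := congr1 (mcoeff m) x0; rewrite (bigD1_seq (Posz d)) //= mcoeffD mcoeff0.
rewrite linear_sum big1 ?addr0 // => -[e|n] ne.
  apply: (dhomog_nemf_coeff (xg (Posz e))).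
  by apply: contraNneq ne => <-; rewrite -md.
by rewrite /= (xg (Negz n)) mcoeff0.
Qed.

End HalfGrading.

(** * The Ramanujan vector field acts as q d/dq *)

Section EulerOperatorOnPolynomials.
Variable K : comNzRingType.
Implicit Types p q : {poly K}.

Lemma coef_euler_add p q p' q' n :
  p'`_n = n%:R * p`_n -> q'`_n = n%:R * q`_n -> (p' + q')`_n = n%:R * (p + q)`_n.
Proof. by move=> pE qE; rewrite !coefD pE qE mulrDr. Qed.

(** The operator q d/dq is a derivation, and its Leibniz rule for the coefficient n
    only involves the coefficients up to n, so it survives truncation. *)
Lemma coef_euler_mul p q p' q' n :
  (forall k, (k <= n)%N -> p'`_k = k%:R * p`_k) ->
  (forall k, (k <= n)%N -> q'`_k = k%:R * q`_k) ->
  (p' * q + p * q')`_n = n%:R * (p * q)`_n.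
Proof.
move=> pE qE; rewrite coefD !coefM -big_split mulr_sumr; apply: eq_bigr => k _ /=.
have kn : (k <= n)%N by rewrite -ltnS.
by rewrite pE // qE ?leq_subr // natrB //; ring.
Qed.

End EulerOperatorOnPolynomials.

Section QDerivative.
Variable R : realType.
Local Notation C := (R[i]).
Local Notation Q := {mpoly C[3]}.
Implicit Types (f g : Q).

Definition ramanujan_derivation : Q -> Q := vector_field (@ramanujan C).

Lemma eisenstein_coefE :
  [/\ eisenstein_coef R ix2 = eisenstein (- 24) 1,
      eisenstein_coef R ix4 = eisenstein 240 3
    & eisenstein_coef R ix6 = eisenstein (- 504) 5].
Proof. by []. Qed.

(** Expansions are truncated at order N for all polynomials at once, which makes
    evaluation a ring morphism; [qcoef] uses N = n for the coefficient n. *)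
Definition q_expansion N : Q -> {poly C} :=
  mmap (@polyC C) (fun i => \poly_(j < N.+1) eisenstein_coef R i j).
HB.instance Definition _ N := GRing.RMorphism.on (q_expansion N).

Lemma coef_generator N n i : (n <= N)%N ->
  (q_expansion N 'X_i)`_n = eisenstein_coef R i n.
Proof. by move=> nN; rewrite /q_expansion mmapX mmap1U coef_poly ltnS nN. Qed.

Lemma q_expansionZ N c f : q_expansion N (c *: f) = c *: q_expansion N f.
Proof. by rewrite /q_expansion mmapZ mul_polyC. Qed.

Lemma q_expansionD N f g : q_expansion N (f + g) = q_expansion N f + q_expansion N g.
Proof. exact: raddfD. Qed.

Lemma q_expansionM N f g : q_expansion N (f * g) = q_expansion N f * q_expansion N g.
Proof. exact: rmorphM. Qed.

Lemma coef_generatorM N n i j : (n <= N)%N ->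
  (q_expansion N ('X_i * 'X_j))`_n =
  \sum_(k < n.+1) eisenstein_coef R i k * eisenstein_coef R j (n - k).
Proof.
move=> nN; rewrite rmorphM coefM; apply: eq_bigr => k _.
have kn : (k <= n)%N by rewrite -ltnS.
by rewrite !coef_generator // ?(leq_trans kn) // (leq_trans (leq_subr _ _)).
Qed.

(** Below the order of truncation, products of truncated series have the Cauchy
    coefficients, to which Ramanujan's equations apply. *)
Lemma ramanujan_generators N n i : (n <= N)%N ->
  (q_expansion N (ramanujan C i))`_n = n%:R * (q_expansion N 'X_i)`_n.
Proof.
move=> nN; have [E2 E4 E6] := eisenstein_coefE.
elim/ord3_ind: i; rewrite /ramanujan /= q_expansionZ rmorphB coefZ coefB.
all: rewrite [X in _ = _ * X](coef_generator _ nN) [X in _ * (X - _)](coef_generatorM _ _ nN).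
- by rewrite [X in _ * (_ - X)](coef_generator _ nN) E2 E4 ramanujan_E2.
- by rewrite [X in _ * (_ - X)](coef_generator _ nN) E2 E4 E6 ramanujan_E4.
- by rewrite [X in _ * (_ - X)](coef_generatorM _ _ nN) E2 E4 E6 ramanujan_E6.
Qed.

Lemma q_expansion_derivation N f n : (n <= N)%N ->
  (q_expansion N (ramanujan_derivation f))`_n = n%:R * (q_expansion N f)`_n.
Proof.
set D := ramanujan_derivation; elim/mpoly_alg_ind: f n => [c|i|f g Pf Pg|f g Pf Pg] n nN.
- rewrite /D /ramanujan_derivation vector_fieldC raddf0 coef0 /q_expansion mmapC coefC.
  by case: n {nN} => [|n]; rewrite ?mul0r ?mulr0.
- by rewrite /D /ramanujan_derivation vector_fieldX ramanujan_generators.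
- have -> : D (f + g) = D f + D g by exact: linearD.
  rewrite (q_expansionD N (D f) (D g)) (q_expansionD N f g).
  exact: coef_euler_add (Pf n nN) (Pg n nN).
have -> : D (f * g) = D f * g + f * D g by exact: vector_fieldM.
rewrite (q_expansionD N (D f * g) (f * D g)) (q_expansionM N (D f) g).
rewrite (q_expansionM N f (D g)) (q_expansionM N f g).
by apply: coef_euler_mul => k kn; [apply: Pf|apply: Pg]; exact: leq_trans nN.
Qed.

Lemma ramanujan_q_derivative : is_q_derivative ramanujan_derivation.
Proof. by move=> f n; apply: q_expansion_derivation. Qed.

End QDerivative.

(** * The quasi-vertex operator algebra *)

Section QuasiVOA.
Variable R : realType.
Local Notation C := (R[i]).
Local Notation Q := {mpoly C[3]}.
Implicit Types (f g : Q).
Local Notation theta := (vector_field (@ramanujan C)).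
Local Notation L1 := (vector_field (@lowering C)).
Local Notation L0 := (vector_field (@euler_field C 3)).

Lemma YprodE f m g : Yprod theta f m g = mode theta m f * g.
Proof. by case: m => n //=; rewrite mul0r. Qed.

Lemma lowering_fieldE f : L1 f = 12 *: mderiv ord0 f.
Proof.
rewrite /vector_field (bigD1 ord0) //= /lowering /= mul_mpolyC big1 ?addr0 // => i i0.
by rewrite -[val i == _]/(i == ord0) (negbTE i0) mul0r.
Qed.

Lemma rho1E f : rho theta 1 f = L1 f.
Proof. by rewrite /rho eqxx /delta scaleNr opprK lowering_fieldE. Qed.

Lemma rho0E f : rho theta 0 f = L0 f.
Proof. by rewrite euler_fieldE. Qed.

Lemma rho_m1E f : rho theta (-1) f = theta f.
Proof. by []. Qed.

Lemma theta_homog d f : f \is d.-homog for (@mnmwgt 3) ->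
  theta f \is (d + 1).-homog for (@mnmwgt 3).
Proof. by move=> fd; apply: vector_field_shift fd (@ramanujan_homog C). Qed.

Lemma divided_power_homog d m f : f \is d.-homog for (@mnmwgt 3) ->
  divided_power theta m f \is (d + m).-homog for (@mnmwgt 3).
Proof.
move=> fd; apply/rpredZ; elim: m => [|m IH]; first by rewrite addn0.
have -> : (d + m.+1 = (d + m) + 1)%N by lia.
exact: theta_homog.
Qed.

Lemma half_grading_mode (k l m : int) f g : half_grading k f -> half_grading l g ->
  half_grading (k + l - m - 1) (mode theta m f * g).
Proof.
have zero n : half_grading n (0 : Q) by exact: gr_zero (half_grading_direct R) n.
case: m => [m|m]; first by rewrite mul0r.
case: k => [k|k]; last by move=> ->; rewrite linear0 mul0r.
case: l => [l|l]; last by move=> _ ->; rewrite mulr0.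
move=> /= fk gl; have -> : Posz k + Posz l - Negz m - 1 = Posz (k + m + l) by lia.
exact: dhomogM (divided_power_homog m fk) gl.
Qed.

(** In weight 0 the image must vanish, because all negative weight spaces do. *)
Lemma half_grading_lowering (k : int) f : half_grading k f -> half_grading (k - 1) (L1 f).
Proof.
case: k => [[|d]|n] fk.
- by rewrite lowering_fieldE (mderiv_homog_small _ fk) // scaler0.
- have -> : Posz d.+1 - 1 = Posz d by lia.
  rewrite lowering_fieldE; apply/rpredZ.
  by rewrite -[d]subn0 -subSS; apply: mderiv_homog.
- have -> : Negz n - 1 = Negz n.+1 by lia.
  by rewrite /= fk linear0.
Qed.

Lemma half_grading_euler (k : int) f : half_grading k f -> L0 f = k%:~R *: f.
Proof.
by case: k => [d|n] /= fk; [rewrite (euler_field_homog fk)|rewrite fk linear0 scaler0].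
Qed.

Theorem quasi_modular_qvoa : is_qvoa (@half_grading R) (Yprod theta) 1 (rho theta).
Proof.
have thetaM f g : theta (f * g) = theta f * g + f * theta g by exact: vector_fieldM.
have cases (m : int) : -1 <= m <= 1 -> [\/ m = -1, m = 0 | m = 1].
  move=> m1; have : m = -1 \/ m = 0 \/ m = 1 by lia.
  by case=> [|[]] ?; [apply: Or31|apply: Or32|apply: Or33].
split.
- by apply: (@holomorphic_vertex_algebra _ _ theta) => //; exact: YprodE.
- exact: half_grading_direct.
- case=> d /=; first exact: homog_finite_dim.
  by exists [::] => // v ->; exists (fun=> 0); rewrite /= big_ord0.
- by exists 0 => -[].
- by move=> k l n a b ka lb; rewrite YprodE; exact: half_grading_mode.
- move=> m /cases[] ->; move=> c f g; rewrite ?rho1E ?rho0E ?rho_m1E; exact: linearP.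
- move=> m n v /cases[] -> /cases[] ->; rewrite ?rho1E ?rho0E ?rho_m1E.
  + by rewrite !subrr scale0r.
  + by rewrite -opprB euler_ramanujan -scaleNr.
  + by rewrite -opprB lowering_ramanujan -scaleNr.
  + by rewrite euler_ramanujan.
  + by rewrite !subrr scale0r.
  + by rewrite -opprB lowering_euler -scaleNr.
  + by rewrite lowering_ramanujan.
  + by rewrite lowering_euler.
  + by rewrite !subrr scale0r.
- by move=> a; rewrite YprodE mulr1 /= /divided_power invr1 scale1r.
- by move=> k a ka; rewrite rho0E; exact: half_grading_euler.
- by move=> k a ka; rewrite rho1E; exact: half_grading_lowering.
- move=> k n a b ka; rewrite !YprodE !rho_m1E thetaM addrK mode_derivation; split=> //.
  by rewrite -mode_derivation derivation_mode mulNr -scalerAl.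
- move=> k n a b ka; rewrite !YprodE !rho1E vector_fieldM addrK.
  rewrite (@lowering_mode _ _ theta L1 L0 k) ?mulrDl ?scalerAl //.
    by move=> x; exact: lowering_ramanujan.
  move=> m; apply: half_grading_euler; case: k ka => [d|d] ka.
    exact: divided_power_homog.
  by rewrite [a]ka linear0; exact: gr_zero (half_grading_direct R) _.
Qed.

End QuasiVOA.

Theorem theorem6p1 (R : realType) :
  exists theta : {mpoly (R[i])[3]} -> {mpoly (R[i])[3]},
    is_q_derivative theta /\
    is_qvoa (@half_grading R) (Yprod theta) 1 (rho theta).
Proof.
exists (ramanujan_derivation (R := R)); split; first exact: ramanujan_q_derivative.
exact: quasi_modular_qvoa.
Qed.
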